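(* Let $f=\sum_ia_ix^i\in R[x^{\pm1}]$ have unit constant coefficient $a_0\in R^\times$, and let $\alpha\in\mathbb Q$ be positive with $v(a_i)\ge\alpha|i|$ for all $i<0$. Let $f=h^2+g$ be an odd decomposition. Then for every $\lambda\in\mathbb Q$ with $0<\lambda<\alpha$ the decomposition $$f(2^\lambda u)=h(2^\lambda u)^2+g(2^\lambda u)$$ of Laurent polynomials in the variable $u$ is optimal.
   Context: $R_1$ is a complete discrete valuation ring with quotient field $K_1$ of characteristic $0$ and residue field of characteristic $2$; $K$ is an algebraic closure of $K_1$; $R$ is the integral closure of $R_1$ in $K$, a valuation ring with $\mathbb Q$-valued valuation $v$ normalized by $v(2)=1$. A group homomorphism $\mathbb Q\to K^\times$, $\alpha\mapsto2^\alpha$, with $2^1=2$ is fixed, so $v(2^\alpha)=\alpha$. For a Laurent polynomial $f=\sum_i a_ix^i$ over $K$ put $v(f):=\inf_i v(a_i)$. For a Laurent polynomial $f$ over $R$ with $v(f)=0$ put $w(f):=\sup\{v(f-h^2)\}\in\mathbb R\cup\{\infty\}$, where $h$ ranges over Laurent polynomials over $R$ in the same variable. A decomposition $f=h^2+g$ with Laurent polynomials $g,h$ over $R$ is called optimal if $v(g)=w(f)$ or $v(g)>2$. A decomposition $f=h^2+g$ with $g,h\in K[x^{\pm1}]$ is called odd if $g$ contains only monomials with odd exponents. *)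

(* Defs.v *)
From HB Require Import structures.
From mathcomp Require Import all_boot all_order all_algebra finmap.
From mathcomp Require Import boolp classical_sets reals constructive_ereal ereal.

Set Implicit Arguments.
Unset Strict Implicit.
Unset Printing Implicit Defensive.

Import Order.TTheory GRing.Theory Num.Theory.

Local Open Scope classical_set_scope.
Local Open Scope ring_scope.

(* Laurent polynomials are finitely supported families of coefficients indexed
   by int; [f i] is the coefficient of x^i in f. *)
Record laurent (A : nzRingType) := Laurent {
  lcoefs : {fsfun int -> A with 0%R} }.

HB.instance Definition _ (A : nzRingType) := [isNew for @lcoefs A].
HB.instance Definition _ (A : nzRingType) := [Choice of laurent A by <:].

Definition lcoef (A : nzRingType) (f : laurent A) : int -> A := lcoefs f.
Coercion lcoef : laurent >-> Funclass.

Section LaurentRing.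
Variable A : nzRingType.
Implicit Types (f g h : laurent A) (i j k : int) (s : {fset int}).

Definition lsupp f : {fset int} := finsupp (lcoefs f).

Definition lzero : laurent A := Laurent [fsfun].
Definition lone : laurent A :=
  Laurent [fsfun i in [fset 0%R : int]%fset => (1%R : A) | 0%R].
Definition lopp f : laurent A :=
  Laurent [fsfun i in lsupp f => - f i | 0%R].
Definition ladd f g : laurent A :=
  Laurent [fsfun i in (lsupp f `|` lsupp g)%fset => f i + g i | 0%R].
Definition lmul f g : laurent A :=
  Laurent [fsfun k in [fset (i + j)%R | i in lsupp f, j in lsupp g]%fset =>
             \sum_(i <- lsupp f) f i * g (k - i) | 0%R].

Lemma laurentP f g : (forall i, f i = g i) -> f = g.
Proof.
by case: f g => [f] [g] fg; congr Laurent; apply/fsfunP => i; exact: fg.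
Qed.

Lemma lsuppE f i : (i \in lsupp f) = (f i != 0).
Proof. by rewrite mem_finsupp. Qed.

Lemma lzeroE i : lzero i = 0.
Proof. by rewrite /lcoef fsfun0E. Qed.

Lemma loneE i : lone i = (i == 0)%:R.
Proof. by rewrite /lcoef fsfunE in_fset1; case: eqP. Qed.

Lemma loppE f i : lopp f i = - f i.
Proof.
rewrite {1}/lcoef fsfunE lsuppE.
by have [->|//] := eqVneq (f i) 0; rewrite oppr0.
Qed.

Lemma laddE f g i : ladd f g i = f i + g i.
Proof.
rewrite {1}/lcoef fsfunE in_fsetU !lsuppE.
have [->|//] := eqVneq (f i) 0.
by have [->|//] := eqVneq (g i) 0; rewrite addr0.
Qed.

Lemma lmulE f g k : lmul f g k = \sum_(i <- lsupp f) f i * g (k - i).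
Proof.
rewrite {1}/lcoef fsfunE; case: ifP => // kN.
rewrite big_seq big1 // => i fi.
have [->|gi] := eqVneq (g (k - i)) 0; first by rewrite mulr0.
case/negP: (negbT kN); apply/imfset2P; exists i => //.
by exists (k - i); rewrite /= ?lsuppE // addrC subrK.
Qed.

Lemma big_fset_supp (F : int -> A) s1 s2 :
    (forall i, F i != 0 -> i \in s1) -> (forall i, F i != 0 -> i \in s2) ->
  \sum_(i <- s1) F i = \sum_(i <- s2) F i.
Proof.
move=> s1F s2F.
have red s : \sum_(i <- s) F i = \sum_(i <- [seq i <- s | F i != 0]) F i.
  rewrite big_filter [RHS]big_mkcond; apply: eq_bigr => i _.
  by case: eqP => [->|].
rewrite (red s1) (red s2); apply: perm_big; apply: uniq_perm.
- by rewrite filter_uniq ?fset_uniq.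
- by rewrite filter_uniq ?fset_uniq.
move=> i; rewrite !mem_filter; case: (boolP (F i != 0)) => //= Fi.
by rewrite s1F // s2F.
Qed.

Lemma lmulE_supp f g k s : {subset lsupp f <= s} ->
  lmul f g k = \sum_(i <- s) f i * g (k - i).
Proof.
move=> sf; rewrite lmulE; apply: big_fset_supp => i.
- by apply: contra_neqT; rewrite lsuppE negbK => /eqP->; rewrite mul0r.
- move=> fgi; apply: sf; rewrite lsuppE; apply: contra_neq fgi => ->.
  by rewrite mul0r.
Qed.

Lemma laddA : associative ladd.
Proof. by move=> f g h; apply/laurentP => i; rewrite !laddE addrA. Qed.

Lemma laddC : commutative ladd.
Proof. by move=> f g; apply/laurentP => i; rewrite !laddE addrC. Qed.

Lemma ladd0 : left_id lzero ladd.
Proof. by move=> f; apply/laurentP => i; rewrite laddE lzeroE add0r. Qed.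

Lemma laddN : left_inverse lzero lopp ladd.
Proof.
by move=> f; apply/laurentP => i; rewrite laddE loppE lzeroE addNr.
Qed.

HB.instance Definition _ :=
  GRing.isZmodule.Build (laurent A) laddA laddC ladd0 laddN.

Lemma lmulA : associative lmul.
Proof.
move=> f g h; apply/laurentP => k.
pose s := [fset (i + j)%R | i in lsupp f, j in lsupp g]%fset.
have s_fg : {subset lsupp (lmul f g) <= s}.
  move=> l; rewrite lsuppE; apply: contra_neqT => lNs.
  by rewrite /lcoef fsfunE (negbTE lNs).
rewrite (lmulE_supp h k s_fg) lmulE.
under [RHS]eq_bigr do rewrite lmulE mulr_suml.
rewrite exchange_big /=; apply: eq_big_seq => i fi.
under [RHS]eq_bigr do rewrite -mulrA.
rewrite -mulr_sumr lmulE; congr (_ * _).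
pose t := [fset (i + j)%R | j in lsupp g]%fset.
transitivity (\sum_(l <- t) g (l - i) * h (k - l)).
  rewrite /t big_imfset /=; last by move=> ? ? _ _; exact: addrI.
  by apply: eq_bigr => j _; rewrite [i + j]addrC addrK (addrC j) opprD addrA.
have gt l : g (l - i) * h (k - l) != 0 -> l - i \in lsupp g.
  by apply: contra_neqT; rewrite lsuppE negbK => /eqP->; rewrite mul0r.
apply: big_fset_supp => l /gt gl.
- by apply/imfsetP; exists (l - i) => //=; rewrite addrC subrK.
- by apply/imfset2P; exists i => //; exists (l - i) => //=; rewrite addrC subrK.
Qed.

Lemma lmul1 : left_id lone lmul.
Proof.
move=> f; apply/laurentP => k.
rewrite (@lmulE_supp _ _ _ [fset 0%R]%fset); last first.
  move=> i; rewrite lsuppE loneE in_fset1.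
  by have [//|_] := eqVneq i 0; rewrite mulr0n eqxx.
by rewrite big_seq_fset1 loneE eqxx mul1r subr0.
Qed.

Lemma lmulr1 : right_id lone lmul.
Proof.
move=> f; apply/laurentP => k.
rewrite lmulE (@big_fset_supp _ _ [fset k]%fset).
- by rewrite big_seq_fset1 loneE subrr eqxx mulr1.
- by move=> i; rewrite lsuppE; apply: contra_neq => ->; rewrite mul0r.
move=> i; rewrite loneE in_fset1 subr_eq0 (eq_sym k).
by have [//|_] := eqVneq i k; rewrite mulr0n mulr0 eqxx.
Qed.

Lemma lmulDl : left_distributive lmul ladd.
Proof.
move=> f g h; apply/laurentP => k; rewrite laddE.
pose s := (lsupp f `|` lsupp g)%fset.
rewrite (@lmulE_supp _ _ _ s); last first.
  move=> i; rewrite lsuppE laddE in_fsetU !lsuppE; apply: contra_neqT.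
  by rewrite negb_or !negbK => /andP[/eqP-> /eqP->]; rewrite addr0.
rewrite !(@lmulE_supp _ _ _ s); do ?by move=> i; rewrite in_fsetU => ->; rewrite ?orbT.
by rewrite -big_split; apply: eq_bigr => i _; rewrite laddE mulrDl.
Qed.

Lemma lmulDr : right_distributive lmul ladd.
Proof.
move=> f g h; apply/laurentP => k; rewrite laddE !lmulE -big_split.
by apply: eq_bigr => i _; rewrite laddE mulrDr.
Qed.

Lemma lone_neq0 : lone != lzero.
Proof.
apply/eqP => /(congr1 (fun f : laurent A => f 0)) /eqP.
by rewrite loneE lzeroE oner_eq0.
Qed.

HB.instance Definition _ :=
  GRing.Zmodule_isNzRing.Build (laurent A)
    lmulA lmul1 lmulr1 lmulDl lmulDr lone_neq0.

Lemma lcoefD f g i : (f + g) i = f i + g i. Proof. exact: laddE. Qed.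

Lemma lcoefN f i : (- f) i = - f i. Proof. exact: loppE. Qed.

Lemma lcoefM f g k : (f * g) k = \sum_(i <- lsupp f) f i * g (k - i).
Proof. exact: lmulE. Qed.

End LaurentRing.

Section LaurentComRing.
Variable A : comNzRingType.

Lemma lmulC : commutative (@lmul A).
Proof.
move=> f g; apply/laurentP => k; rewrite !lmulE.
transitivity (\sum_(l <- [fset k - j | j in lsupp g]%fset) f l * g (k - l)).
  apply: big_fset_supp => i.
    by rewrite lsuppE; apply: contra_neq => ->; rewrite mul0r.
  move=> fg; apply/imfsetP; exists (k - i); last by rewrite subKr.
  by rewrite /= lsuppE; apply: contra_neq fg => ->; rewrite mulr0.
rewrite big_imfset /=; last by move=> ? ? _ _ /addrI/oppr_inj.
by apply: eq_bigr => j _; rewrite subKr mulrC.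
Qed.

HB.instance Definition _ :=
  GRing.PzRing_hasCommutativeMul.Build (laurent A) lmulC.

End LaurentComRing.

(* f(c u), as a Laurent polynomial in u; meant for an invertible c. *)
Definition lscale (A : unitRingType) (c : A) (f : laurent A) : laurent A :=
  Laurent [fsfun i in lsupp f => f i * c ^ i | 0%R].

Lemma lscaleE (A : unitRingType) (c : A) (f : laurent A) i :
  lscale c f i = f i * c ^ i.
Proof.
rewrite {1}/lcoef fsfunE lsuppE.
by have [->|//] := eqVneq (f i) 0; rewrite mul0r.
Qed.

Definition valuation (F : fieldType) (G : realDomainType) (v : F -> \bar G) :=
  [/\ forall x, v x != -oo%E,
      forall x, (v x == +oo%E) = (x == 0),
      forall x y, v (x * y) = (v x + v y)%E
    & forall x y, (Order.min (v x) (v y) <= v (x + y)%R)%E].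

(* R1 is the valuation ring of a discrete valuation nu, normalized to have
   value group int, of its field of fractions. *)
Definition discrete_valuation_ring (R1 : idomainType)
    (nu : {fraction R1} -> \bar int) :=
  [/\ valuation nu,
      forall n : int, exists x, nu x = n%:E
    & forall x, (0 <= nu x)%E <-> exists a : R1, x = FracField.tofrac a].

Definition complete_for (R1 : idomainType) (nu : {fraction R1} -> \bar int) :=
  forall a : nat -> R1,
    (forall n : nat, exists N : nat, forall i j : nat,
       (N <= i)%N -> (N <= j)%N ->
       ((n%:Z)%:E <= nu (FracField.tofrac (a i - a j)%R))%E) ->
  exists l : R1, forall n : nat, exists N : nat, forall i : nat,
    (N <= i)%N -> ((n%:Z)%:E <= nu (FracField.tofrac (a i - l)%R))%E.

Definition complete_dvr (R1 : idomainType) :=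
  exists2 nu, @discrete_valuation_ring R1 nu & complete_for nu.

(* For a local ring R1, [res] exhibits k as its residue field: the kernel is
   the maximal ideal, i.e. the set of non-units. *)
Definition is_residue_map (R1 : idomainType) (k : fieldType)
    (res : {rmorphism R1 -> k}) :=
  (forall y, exists x, res x = y) /\
  (forall x, (res x == 0) = (x \isn't a GRing.unit)).

Definition is_algebraic_closure (F : fieldType) (K : closedFieldType)
    (iota : {rmorphism F -> K}) :=
  forall x, algebraicOver iota x.

Definition in_integral_closure (R1 : idomainType) (K : closedFieldType)
    (iota : {rmorphism {fraction R1} -> K}) (x : K) : Prop :=
  integralOver (fun a : R1 => iota (FracField.tofrac a)) x.

Section OptimalDecomposition.
(* [inR] is membership in the valuation ring R. The real numbers RR serve only
   to take infima and suprema of rational values. *)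
Variables (RR : realType) (K : fieldType) (inR : K -> Prop) (v : K -> \bar rat).
Implicit Types f g h : laurent K.

Definition laurent_over f := forall i : int, inR (f i).

Definition laurent_val f : \bar RR :=
  ereal_inf [set er_map ratr (v (f i)) | i in [set: int]].

(* Meaningful for f over R with laurent_val f = 0. *)
Definition laurent_w f : \bar RR :=
  ereal_sup [set laurent_val (f - h ^+ 2) | h in [set h | laurent_over h]].

Definition optimal_decomposition f h g :=
  [/\ laurent_over f /\ laurent_val f = 0%E,
      laurent_over h,
      laurent_over g,
      f = h ^+ 2 + g
    & laurent_val g = laurent_w f \/ (2%:E < laurent_val g)%E].

End OptimalDecomposition.

Definition odd_decomposition (K : fieldType) (f h g : laurent K) :=
  f = h ^+ 2 + g /\ forall i : int, g i != 0 -> odd `|i|%N.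

(* Main.v *)
(* The coefficient of x^(2i) in h^2 is h_i^2 up to twice a sum of products of
   coefficients of h. Since g has no even monomials, comparing the coefficients
   at 2n, where h_n has least valuation, shows that h is integral; after scaling,
   f is congruent to a constant, hence so is h. If h' = h + d did better than h,
   i.e. if d^2 + 2hd = g - g' with v(g') > v(g), let δ = v(d). The coefficients at
   even exponents give 2δ >= v(g) if δ < 1, while an odd coefficient of g of
   least valuation gives v(g) >= 1 + min(δ, 2δ) = 1 + δ. Hence δ >= 1, and
   v(g) <= 2 forces v(g) = 2 and δ = 1. Modulo the maximal ideal, e = d/2 then
   satisfies e^2 + h_0 e = g/4 with g/4 odd and nonzero, which no Laurent
   polynomial does: its nonzero exponents would be stable under doubling. *)
Require Import Defs.
From mathcomp Require Import all_boot all_order all_algebra finmap.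
From mathcomp Require Import reals constructive_ereal ereal.
From mathcomp Require Import zify ring lra.

Set Implicit Arguments.
Unset Strict Implicit.
Unset Printing Implicit Defensive.

Import Order.TTheory GRing.Theory Num.Theory.

Local Open Scope ring_scope.

(** * Coefficients of the square of a Laurent polynomial *)

Section LaurentSquare.
Variable A : comNzRingType.
Implicit Types (f g : laurent A) (i n : int).

Lemma lcoef_finite f : exists N : nat, forall i, f i != 0 -> (`|i| <= N)%N.
Proof.
exists (\max_(i <- lsupp f) `|i|%N)%N => i; rewrite -lsuppE => fi.
exact: leq_bigmax_seq.
Qed.

(** The involution i ↦ n - i swaps the terms with i < n - i and those with i > n - i, so these pair
    up into a multiple of 2. Only a fixed index, which exists exactly for even n, escapes the factor
    2. *)
Lemma lcoef_sqrE f n :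
  (f ^+ 2) n = \sum_(i <- lsupp f | i == n - i) f i * f (n - i) +
               2 * \sum_(i <- lsupp f | i < n - i) f i * f (n - i).
Proof.
have ref : \sum_(i <- lsupp f | i < n - i) f i * f (n - i) =
    \sum_(i <- lsupp f | n - i < i) f i * f (n - i).
  rewrite big_mkcond [RHS]big_mkcond /=.
  pose F i := if n - i < i then f i * f (n - i) else 0.
  transitivity (\sum_(j <- [fset n - i | i in lsupp f]%fset) F j).
    rewrite big_imfset /=; last by move=> ? ? _ _ /addrI/oppr_inj.
    by apply: eq_bigr => i _; rewrite /F subKr mulrC.
  apply: big_fset_supp => i; rewrite /F; case: ifP; rewrite ?eqxx// => _ fi.
    apply/imfsetP; exists (n - i); rewrite ?subKr//= lsuppE.
    by apply: contra_neq fi => ->; rewrite mulr0.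
  by rewrite lsuppE; apply: contra_neq fi => ->; rewrite mul0r.
rewrite mulr_natl mulr2n [X in _ + (_ + X)]ref expr2 lcoefM.
rewrite (bigID (fun i => i == n - i)) /=; congr (_ + _).
rewrite (bigID (fun i => i < n - i)) /=; congr (_ + _); apply: eq_bigl => i.
  by case: ltgtP.
by case: ltgtP.
Qed.

Lemma lcoef_sqr_even f i :
  (f ^+ 2) (i * 2) =
  f i ^+ 2 + 2 * \sum_(j <- lsupp f | j < i * 2 - j) f j * f (i * 2 - j).
Proof.
rewrite lcoef_sqrE; congr (_ + _); rewrite big_mkcond.
rewrite (@big_fset_supp _ _ _ [fset i]%fset).
- rewrite big_seq_fset1 ifT; last by lia.
  by rewrite expr2; congr (_ * f _); lia.
- move=> j; rewrite lsuppE; apply: contra_neq => ->.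
  by rewrite mul0r if_same.
by move=> j; case: ifP => [/eqP ji _|]; rewrite ?eqxx// in_fset1; lia.
Qed.

Lemma lcoef_sqr_odd f n : odd `|n|%N ->
  (f ^+ 2) n = 2 * \sum_(j <- lsupp f | j < n - j) f j * f (n - j).
Proof.
move=> n_odd; rewrite lcoef_sqrE big1 ?add0r// => i /eqP ni.
by exfalso; move: n_odd; lia.
Qed.

End LaurentSquare.

(** * The substitution x = c u as a ring homomorphism *)

Lemma lscaleD (K : fieldType) (c : K) f g :
  lscale c (f + g) = lscale c f + lscale c g.
Proof. by apply/laurentP => i; rewrite lcoefD !lscaleE lcoefD mulrDl. Qed.

(** Exponents may be negative, so c^i c^(n - i) = c^n requires [c] to be invertible. *)
Lemma lscaleM (K : fieldType) (c : K) f g : c != 0 ->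
  lscale c (f * g) = lscale c f * lscale c g.
Proof.
move=> c0; apply/laurentP => n; rewrite lscaleE lcoefM mulr_suml.
rewrite lcoefM [RHS](@big_fset_supp _ _ _ (lsupp f)) => [|i|i].
- apply: eq_bigr => i _; rewrite !lscaleE mulrACA -expfzDr//.
  by congr (_ * _ ^ _); rewrite subrKC.
- by rewrite lsuppE; apply: contra_neq => ->; rewrite mul0r.
by rewrite lsuppE lscaleE; apply: contra_neq => ->; rewrite !mul0r.
Qed.

(** * Valuations with rational values, on elements and on Laurent polynomials *)

Section Valuation.
Variables (K : fieldType) (v : K -> \bar rat).
Hypothesis vP : valuation v.
Implicit Types (x y : K) (c d : rat) (f g h : laurent K).

Local Lemma vM x y : v (x * y) = (v x + v y)%E. Proof. by case: vP. Qed.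

Lemma val0 : v 0 = +oo%E. Proof.
by case: vP => _ + _ _ => /(_ 0); rewrite eqxx => /eqP.
Qed.

Lemma valE x : x != 0 -> exists c, v x = c%:E.
Proof.
case: vP => /(_ x) + /(_ x) + _ _.
by case: (v x) => [c _ _ _|_ <-|]//; exists c.
Qed.

Lemma val1 : v 1 = 0%E.
Proof.
have [c v1] := valE (oner_neq0 K); have := vM 1 1.
by rewrite mulr1 v1 => -[] ?; congr (_%:E); lra.
Qed.

Lemma valN x : v (- x) = v x.
Proof.
have N1 : (-1 : K) != 0 by rewrite oppr_eq0 oner_neq0.
have [c vN1] := valE N1; have := vM (-1) (-1).
rewrite mulrNN mulr1 val1 vN1 => -[] c0.
rewrite -mulN1r vM vN1 (_ : c = 0) ?add0e//; lra.
Qed.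

Lemma val_exprz x c (n : int) : v x = c%:E -> v (x ^ n) = (c * n%:~R)%:E.
Proof.
move=> vx.
have x0 : x != 0 by apply/eqP => x0; move: vx; rewrite x0 val0.
have nat_case (m : nat) : v (x ^+ m) = (c * m%:R)%:E.
  elim: m => [|m IH]; first by rewrite expr0 val1 mulr0.
  by rewrite exprS vM vx IH -EFinD; congr (_%:E); rewrite -natr1; ring.
case: n => m; first exact: nat_case.
rewrite NegzE -exprnN.
have xm : x ^- m.+1 != 0 by rewrite invr_neq0// expf_neq0.
have [d vd] := valE xm; have := vM (x ^+ m.+1) (x ^- m.+1).
rewrite mulfV ?expf_neq0// val1 vd nat_case -EFinD => -[] E.
by congr (_%:E); rewrite mulrNz mulrN; apply/eqP; rewrite -addr_eq0 addrC -E.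
Qed.

Lemma le_valD a x y : (a <= v x)%E -> (a <= v y)%E -> (a <= v (x + y)%R)%E.
Proof.
by move=> ax ay; case: vP => _ _ _ /(_ x y); apply: le_trans; rewrite le_min ax.
Qed.

Lemma lt_valD a x y : (a < v x)%E -> (a < v y)%E -> (a < v (x + y)%R)%E.
Proof.
move=> ax ay; case: vP => _ _ _ /(_ x y); apply: lt_le_trans.
by rewrite lt_min ax.
Qed.

Lemma le_valM c d x y :
  (c%:E <= v x)%E -> (d%:E <= v y)%E -> ((c + d)%:E <= v (x * y)%R)%E.
Proof. by move=> cx dy; rewrite vM EFinD leeD. Qed.

Lemma lt_valMl c d x y :
  (c%:E < v x)%E -> (d%:E <= v y)%E -> ((c + d)%:E < v (x * y)%R)%E.
Proof.
rewrite vM; case: (v x) => [a||]//; case: (v y) => [b||]//.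
- by rewrite -EFinD !lte_fin lee_fin; lra.
- by move=> _ _; rewrite ?addey ?addye // ltry.
- by move=> _ _; rewrite ?addey ?addye // ltry.
by move=> _ _; rewrite ltry.
Qed.

Lemma lt_valMr c d x y :
  (c%:E <= v x)%E -> (d%:E < v y)%E -> ((c + d)%:E < v (x * y)%R)%E.
Proof. by move=> ? ?; rewrite addrC mulrC; apply: lt_valMl. Qed.

Lemma le_val_sum (I : eqType) (r : seq I) (P : pred I) (F : I -> K) c :
  (forall i, P i -> (c%:E <= v (F i))%E) ->
  (c%:E <= v (\sum_(i <- r | P i) F i)%R)%E.
Proof.
apply: (big_ind (fun x => (c%:E <= v x)%E)); rewrite ?val0 ?leey//.
exact: le_valD.
Qed.

Lemma lt_val_sum (I : eqType) (r : seq I) (P : pred I) (F : I -> K) c :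
  (forall i, P i -> (c%:E < v (F i))%E) ->
  (c%:E < v (\sum_(i <- r | P i) F i)%R)%E.
Proof.
apply: (big_ind (fun x => (c%:E < v x)%E)); rewrite ?val0 ?ltry//.
exact: lt_valD.
Qed.

(** Negated, this turns a strict lower bound on a square into one on its root; each estimate of a
    coefficient through its square ends here. *)
Lemma le_val_sqr c x : (v (x ^+ 2) <= (c + c)%:E)%E = (v x <= c%:E)%E.
Proof.
rewrite expr2 vM; case: (v x) => [a||].
- by rewrite -EFinD !lee_fin; lra.
- by rewrite addye// !leye_eq.
by rewrite /= !leNye.
Qed.

(** The support is finite, and coefficients outside it have valuation +oo. *)
Lemma ex_min_val f : exists i, forall j, (v (f i) <= v (f j))%E.
Proof.
have [i fi] : exists i, forall j,
    j \in (lsupp f : seq int) -> (v (f i) <= v (f j))%E.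
  elim: (lsupp f : seq int) => [|j s [i IH]]; first by exists 0.
  have [ij|ji] := leP (v (f i)) (v (f j)).
    by exists i => l; rewrite inE => /orP[/eqP->//|/IH].
  exists j => l; rewrite inE => /orP[/eqP->//|/IH]; exact: le_trans (ltW ji).
exists i => j; have [/fi//|] := boolP (j \in lsupp f).
by rewrite lsuppE negbK => /eqP ->; rewrite val0 leey.
Qed.

Lemma le_er_ratr (RR : realType) (a b : \bar rat) : (a <= b)%E ->
  (er_map ratr a <= er_map (ratr : rat -> RR) b)%E.
Proof.
by case: a => [a||]; case: b => [b||]//=; rewrite ?leey ?leNye// !lee_fin ler_rat.
Qed.

(** An attained infimum is a rational value or +oo, so the estimates below can stay in the extended
    rationals. *)
Lemma laurent_valE (RR : realType) f i : (forall j, (v (f i) <= v (f j))%E) ->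
  laurent_val RR v f = er_map ratr (v (f i)).
Proof.
move=> fi; apply/eqP; rewrite eq_le; apply/andP; split.
  by apply: ereal_inf_lbound; exists i.
by apply: le_ereal_inf_tmp => _ [j _ <-]; exact: le_er_ratr.
Qed.

(** * Cross terms of squares gain valuation 1 from the factor 2 *)

Hypothesis v2 : v 2 = 1%E.

Lemma le_val_mul2 c x : (c%:E <= v x)%E -> ((1 + c)%:E <= v (2 * x)%R)%E.
Proof. by move=> cx; apply: le_valM; rewrite ?v2. Qed.

Lemma lt_val_mul2 c x : (c%:E < v x)%E -> ((1 + c)%:E < v (2 * x)%R)%E.
Proof. by move=> cx; apply: lt_valMr; rewrite ?v2. Qed.

Lemma sqr_even_error f c i : (forall j, (c%:E <= v (f j))%E) ->
  ((1 + (c + c))%:E <= v ((f ^+ 2) (i * 2) - f i ^+ 2)%R)%E.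
Proof.
move=> cf; rewrite lcoef_sqr_even addrAC subrr add0r.
by apply/le_val_mul2/le_val_sum => j _; apply: le_valM.
Qed.

Lemma le_val_sqr_odd f c n : odd `|n|%N -> (forall j, (c%:E <= v (f j))%E) ->
  ((1 + (c + c))%:E <= v ((f ^+ 2) n))%E.
Proof.
move=> n_odd cf; rewrite lcoef_sqr_odd//.
by apply/le_val_mul2/le_val_sum => j _; apply: le_valM.
Qed.

(** * Odd decompositions of a polynomial that is a unit constant modulo the maximal ideal *)

Section OddDecomposition.
Variables f h g : laurent K.
Hypothesis fhg : odd_decomposition f h g.
Hypothesis f0 : v (f 0) = 0%E.
Hypothesis f_gt0 : forall i, i != 0 -> (0 < v (f i))%E.

Local Lemma f_ge0 i : (0 <= v (f i))%E.
Proof. by have [->|/f_gt0/ltW//] := eqVneq i 0; rewrite f0. Qed.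

Local Lemma sqr_even i : (h ^+ 2) (i * 2) = f (i * 2).
Proof.
case: fhg => -> g_odd; rewrite lcoefD.
suff -> : g (i * 2) = 0 by rewrite addr0.
by apply/eqP; apply: contraT => /g_odd; lia.
Qed.

(** Let c < 0 be the least valuation, attained at n. Then h_n^2 is f_(2n), of valuation at least 0 >
    2c, minus cross terms of valuation at least 1 + 2c > 2c, although its own valuation is 2c. *)
Lemma odd_decomposition_ge0 i : (0 <= v (h i))%E.
Proof.
have [n hn] := ex_min_val h.
apply: le_trans (hn i); rewrite leNgt; apply/negP => hn_lt0.
have [c hnc] : exists c, v (h n) = c%:E.
  by apply: valE; apply/eqP => hn0; move: hn_lt0; rewrite hn0 val0.
move: hn_lt0 hn; rewrite hnc lte_fin => c_lt0 hc.
suff : ((c + c)%:E < v (h n ^+ 2))%E by rewrite ltNge le_val_sqr hnc lexx.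
rewrite -[h n ^+ 2](subKr ((h ^+ 2) (n * 2))) sqr_even; apply: lt_valD.
  by apply: lt_le_trans (f_ge0 _); rewrite lte_fin; lra.
rewrite valN -sqr_even; apply: lt_le_trans (sqr_even_error n hc).
by rewrite lte_fin; lra.
Qed.

(** With [h] integral the cross terms at 2i have valuation at least 1, and f_(2i) has positive
    valuation, hence so has h_i^2. *)
Lemma odd_decomposition_gt0 i : i != 0 -> (0 < v (h i))%E.
Proof.
move=> i0; rewrite ltNge -le_val_sqr addr0 -ltNge.
rewrite -[h i ^+ 2](subKr ((h ^+ 2) (i * 2))) sqr_even; apply: lt_valD.
  by apply: f_gt0; lia.
rewrite valN -sqr_even.
apply: lt_le_trans (sqr_even_error i odd_decomposition_ge0).
by rewrite lte_fin.
Qed.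

(** One coefficient already bounds the infimum defining v(f - h'^2), so this says that no competitor
    [h'] improves on [h]. *)
Lemma odd_decomposition_max h' k :
    (forall i, (0 <= v (h' i))%E) ->
    (v (g k) <= 2%:E)%E -> (forall i, (v (g k) <= v (g i))%E) ->
  exists i, (v ((f - h' ^+ 2) i) <= v (g k))%E.
Proof.
case: fhg => f_def g_odd h'_ge0 gk2 gk_min.
set g' := f - h' ^+ 2; have [m g'm] := ex_min_val g'.
have [|gk_lt] := leP (v (g' m)) (v (g k)); first by exists m.
have {g'm}g'_gt i : (v (g k) < v (g' i))%E by exact: lt_le_trans (g'm i).
have gk0 : g k != 0 by apply/eqP => gk0; move: gk2; rewrite gk0 val0.
have k_odd := g_odd _ gk0.
have [c gkc] := valE gk0.
rewrite gkc lee_fin in gk2 gk_min g'_gt.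
pose d := h' - h.
have d_eq i : (d ^+ 2) i + 2 * (h * d) i = g i - g' i.
  rewrite -lcoefN -[RHS]lcoefD (_ : g - g' = d ^+ 2 + (h * d + h * d)).
    by rewrite !lcoefD; ring.
  by rewrite /g' /d f_def; ring.
have gg'_ge i : (c%:E <= v (g i - g' i)%R)%E.
  by apply: le_valD; rewrite ?valN// ltW.
have gg'_k : (v (g k - g' k)%R <= c%:E)%E.
  rewrite leNgt; apply/negP => lt_c.
  have : (c%:E < v (g k - g' k + g' k)%R)%E by exact: lt_valD.
  by rewrite subrK gkc ltxx.
have d_ge0 i : (0 <= v (d i))%E.
  by rewrite lcoefD lcoefN; apply: le_valD; rewrite ?valN// odd_decomposition_ge0.
have hd_ge b i : (forall j, (b%:E <= v (d j))%E) -> (b%:E <= v ((h * d)%R i))%E.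
  move=> db; rewrite lcoefM; apply: le_val_sum => j _.
  by rewrite -[b]add0r; apply: le_valM => //; exact: odd_decomposition_ge0.
(* If the least valuation b of [d] were below 1, the even exponent 2n would give c <= 2b and the odd
   exponent [k] would give 1 + b <= c; together these force b >= 1. *)
have d_ge1 i : (1%:E <= v (d i))%E.
  have [n dn] := ex_min_val d; apply: le_trans (dn i).
  have [//|dn_lt1] := leP 1%:E (v (d n)).
  have [b dnb] : exists b, v (d n) = b%:E.
    by apply: valE; apply/eqP => dn0; move: dn_lt1; rewrite dn0 val0.
  have := d_ge0 n; rewrite dnb lee_fin in dn dn_lt1 * => b_ge0.
  rewrite lte_fin in dn_lt1.
  have cb : c <= b + b.
    rewrite leNgt; apply/negP => lt_c.
    have : ((b + b)%:E < v (d n ^+ 2))%E.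
      have -> : d n ^+ 2 = g (n * 2) - g' (n * 2) - 2 * (h * d) (n * 2)
                           - ((d ^+ 2) (n * 2) - d n ^+ 2).
        by rewrite -d_eq; ring.
      apply: lt_valD; first apply: lt_valD.
      - by apply: lt_le_trans (gg'_ge _); rewrite lte_fin.
      - rewrite valN; apply: lt_le_trans (le_val_mul2 (hd_ge _ _ dn)).
        by rewrite lte_fin; lra.
      - rewrite valN; apply: lt_le_trans (sqr_even_error _ dn).
        by rewrite lte_fin; lra.
    by rewrite ltNge le_val_sqr dnb lexx.
  have : ((1 + b)%:E <= v (g k - g' k)%R)%E.
    rewrite -d_eq; apply: le_valD; last exact: le_val_mul2 (hd_ge _ _ dn).
    by apply: le_trans (le_val_sqr_odd k_odd dn); rewrite lee_fin; lra.
  by move=> /le_trans/(_ gg'_k); rewrite lee_fin; lra.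
have c_ge2 : 2 <= c.
  rewrite -lee_fin; apply: le_trans gg'_k; rewrite -d_eq; apply: le_valD.
    by apply: le_trans (le_val_sqr_odd k_odd d_ge1); rewrite lee_fin.
  by apply: le_trans (le_val_mul2 (hd_ge _ _ d_ge1)); rewrite lee_fin.
have c2 : c = 2 by lra.
subst c => {gk2 c_ge2}.
(* Modulo terms of valuation above 1, the product [h * d] is h_0 d: for j != 0 the factor h_j has
   positive valuation and [d] has valuation at least 1. *)
have hd_gt1 i : (1%:E < v (d i))%E -> (1%:E < v ((h * d)%R i))%E.
  move=> di; rewrite lcoefM; apply: lt_val_sum => j _; rewrite -[1]add0r.
  have [->|j0] := eqVneq j 0.
    by apply: lt_valMr; rewrite ?subr0 ?odd_decomposition_ge0.
  by apply: lt_valMl => //; exact: odd_decomposition_gt0.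
have dk : (v (d k) <= 1%:E)%E.
  rewrite leNgt; apply/negP => /hd_gt1/lt_val_mul2 hdk.
  suff : (2%:E < v (g k - g' k)%R)%E by rewrite ltNge gg'_k.
  rewrite -d_eq; apply: lt_valD => //.
  apply: lt_le_trans (le_val_sqr_odd k_odd d_ge1); by rewrite lte_fin.
(* [(d / 2)^2 + h_0 (d / 2)] has odd reduction to the residue field, so the
   nonzero exponents of the reduction of [d / 2] are stable under doubling. *)
have d_double i : i != 0 -> (v (d i) <= 1%:E)%E -> (v (d (i * 2)%R) <= 1%:E)%E.
  move=> i0 di; rewrite leNgt; apply/negP => /hd_gt1/lt_val_mul2 hdi.
  suff : ((1 + 1)%:E < v (d i ^+ 2))%E by rewrite ltNge le_val_sqr di.
  have -> : d i ^+ 2 = - g' (i * 2) - 2 * (h * d) (i * 2)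
                       - ((d ^+ 2) (i * 2) - d i ^+ 2).
    have -> : - g' (i * 2) = g (i * 2) - g' (i * 2).
      suff -> : g (i * 2) = 0 by rewrite sub0r.
      by apply/eqP; apply: contraT => /g_odd; lia.
    by rewrite -d_eq; ring.
  apply: lt_valD; first by apply: lt_valD; rewrite valN.
  rewrite valN; apply: lt_le_trans (sqr_even_error _ d_ge1).
  by rewrite lte_fin.
have k0 : k != 0 by apply/eqP => k0; rewrite k0 in k_odd.
have d_pow j : (v (d (k * (2 ^ j)%N%:Z)%R) <= 1%:E)%E.
  elim: j => [|j IH]; first by rewrite mulr1.
  rewrite expnSr PoszM mulrA; apply: d_double => //.
  by rewrite mulf_neq0// eqz_nat expn_eq0.
(* [N] bounds the absolute values of the exponents of [d], yet k 2^N is one of them, and |k| 2^N >=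
   2^N > N. *)
have [N dN] := lcoef_finite d.
have /dN : d (k * (2 ^ N)%N%:Z) != 0.
  by apply/eqP => d0; move: (d_pow N); rewrite d0 val0.
rewrite abszM leqNgt => /negP[].
apply: leq_trans (ltn_expl N (ltnSn 1)) _.
by rewrite leq_pmull// absz_gt0.
Qed.

End OddDecomposition.

End Valuation.

(** For a = p/q, the q-th power of [pow a] is the p-th power of [pow 1], so q v(pow a) = p. *)
Lemma val_rat_pow (K : fieldType) (v : K -> \bar rat) (pow : rat -> K) :
    valuation v -> (forall a, pow a != 0) ->
    (forall a b, pow (a + b) = pow a * pow b) -> v (pow 1) = 1%E ->
  forall a, v (pow a) = a%:E.
Proof.
move=> vP pow0 powD v1 a.
have pow_0 : pow 0 = 1.
  by apply: (mulfI (pow0 0)); rewrite -powD addr0 mulr1.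
have powM (b : rat) (n : nat) : pow (b * n%:R) = pow b ^+ n.
  elim: n => [|n IH]; first by rewrite mulr0 pow_0.
  by rewrite -natr1 mulrDr mulr1 powD IH exprSr.
have powMz (b : rat) (n : int) : pow (b * n%:~R) = pow b ^ n.
  case: n => m; first exact: powM.
  apply: (mulIf (expf_neq0 m.+1 (pow0 b))).
  rewrite -powM -powD NegzE mulrNz mulrN addNr pow_0 -exprnN powM mulVf//.
  by rewrite expf_neq0.
have [c vc] := valE vP (pow0 a).
have := val_exprz vP (denq a) vc.
rewrite -powMz -numqE -[(numq a)%:~R]mul1r powMz (val_exprz vP _ v1) mul1r numqE.
by rewrite vc => -[] /(mulIf _)-> //; rewrite intr_eq0 denq_neq0.
Qed.

(** * Passage to the rescaled polynomial and comparison with the supremum w *)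

Theorem proposition3p4p2
  (RR : realType)
  (R1 : idomainType) (k : fieldType) (res : {rmorphism R1 -> k})
  (K : closedFieldType) (iota : {rmorphism {fraction R1} -> K})
  (v : K -> \bar rat) (pow2 : rat -> K)
  (R1_complete_dvr : complete_dvr R1)
  (K1_char0 : [pchar {fraction R1}] =i pred0)
  (k_residue : is_residue_map res)
  (k_char2 : 2%N \in [pchar k])
  (K_closure : is_algebraic_closure iota)
  (v_valuation : valuation v)
  (v_ring : forall x, (0 <= v x)%E <-> in_integral_closure iota x)
  (v_2 : v 2 = 1%E)
  (pow2_neq0 : forall a, pow2 a != 0)
  (pow2D : forall a b, pow2 (a + b) = pow2 a * pow2 b)
  (pow2_1 : pow2 1 = 2)
  (f : laurent K)
  (f_over : laurent_over (in_integral_closure iota) f)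
  (f0_neq0 : f 0 != 0)
  (f0_unit : in_integral_closure iota (f 0)^-1)
  (alpha : rat) (alpha_gt0 : 0 < alpha)
  (f_neg : forall i : int, i < 0 -> ((alpha * `|i|%:~R)%:E <= v (f i))%E)
  (h g : laurent K)
  (fhg_odd : odd_decomposition f h g)
  (lambda : rat) (lambda_gt0 : 0 < lambda) (lambda_lt : lambda < alpha) :
  optimal_decomposition RR (in_integral_closure iota) v
    (lscale (pow2 lambda) f) (lscale (pow2 lambda) h) (lscale (pow2 lambda) g).
Proof.
have powP := val_rat_pow v_valuation pow2_neq0 pow2D (etrans (congr1 v pow2_1) v_2).
have f0 : v (f 0) = 0%E.
  have [c vc] := valE v_valuation f0_neq0.
  have [d vd] := valE v_valuation (invr_neq0 f0_neq0).
  have := val1 v_valuation; rewrite -(mulfV f0_neq0) vM// vc vd => -[] cd.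
  move/v_ring: f0_unit; move/v_ring: (f_over 0).
  by rewrite vc vd !lee_fin => ? ?; congr (_%:E); lra.
set F := lscale (pow2 lambda) f; set H := lscale _ h; set G := lscale _ g.
have F0 : v (F 0) = 0%E by rewrite lscaleE mulr1.
have F_gt0 i : i != 0 -> (0 < v (F i))%E.
  rewrite lscaleE => i0.
  have vpow := val_exprz v_valuation i (powP lambda).
  (* For i > 0 the factor 2^(lambda i) has positive valuation. For i < 0 it costs lambda |i|, which
     is less than the alpha |i| granted by [f_neg]. *)
  have [i_gt0|i_lt0] : 0 < i \/ i < 0 by lia.
    rewrite -[0]add0r; apply: lt_valMr => //; first exact/v_ring.
    by rewrite vpow lte_fin mulr_gt0// ltr0z.
  apply: (@lt_le_trans _ _ (alpha * `|i|%:~R + lambda * i%:~R)%:E).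
    rewrite lte_fin (_ : i%:~R = - `|i|%:~R); last first.
      by rewrite ltr0_norm// mulrNz opprK.
    by rewrite mulrN -mulrBl mulr_gt0 ?subr_gt0// ltr0z normr_gt0.
  by apply: le_valM; rewrite ?vpow//; exact: f_neg.
have FHG : odd_decomposition F H G.
  case: fhg_odd => fE g_odd; split.
    by rewrite /F fE lscaleD !expr2 lscaleM.
  move=> i Gi; apply: g_odd; apply: contra_neq Gi.
  by rewrite lscaleE => ->; rewrite mul0r.
have F_ge0 i : (0 <= v (F i))%E by exact: f_ge0.
have H_ge0 := odd_decomposition_ge0 v_valuation v_2 FHG F0 F_gt0.
split.
- split; first by move=> i; apply/v_ring.
  rewrite (@laurent_valE _ _ RR _ 0) => [|i]; last by rewrite F0.
  by rewrite F0 /= rmorph0.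
- by move=> i; apply/v_ring.
- move=> i; apply/v_ring.
  (* Integrality of [G] is inherited from [F] and [H]. *)
  rewrite (_ : G i = F i - (H ^+ 2) i).
    apply: le_valD; rewrite ?valN// expr2 lcoefM.
    by apply: le_val_sum => // j _; rewrite -[0]addr0; apply: le_valM.
  by case: FHG => -> _; rewrite lcoefD addrAC subrr add0r.
- by case: FHG.
have [n Gn] := ex_min_val v_valuation G.
have Gval := laurent_valE RR Gn.
(* Above 2 the second alternative of optimality holds. Otherwise the supremum is attained at [H]:
   each competitor leaves a coefficient of valuation at most v(G n). *)
have [Gn2|Gn2] := leP (v (G n)) 2%:E; last first.
  right; rewrite Gval; move: Gn2; case: (v (G n)) => [c||]//=; last by rewrite !ltry.
  by rewrite !lte_fin -(ltr_rat RR) rmorph_nat.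
left; apply/eqP; rewrite eq_le; apply/andP; split.
  apply: ereal_sup_ubound; exists H; first by move=> i; apply/v_ring.
  by congr laurent_val; case: FHG => -> _; rewrite addrAC subrr add0r.
apply: ge_ereal_sup => _ [h' h'_over <-].
have h'_ge0 i : (0 <= v (h' i))%E by apply/v_ring.
have [i Fi] := odd_decomposition_max v_valuation v_2 FHG F0 F_gt0 h'_ge0 Gn2 Gn.
apply: (@le_trans _ _ (er_map ratr (v ((F - h' ^+ 2) i)))).
  by apply: ereal_inf_lbound; exists i.
rewrite Gval; exact: le_er_ratr.
Qed.
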